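(* Let $A=\{a_1,a_2,\dots\}$ be a countable alphabet and let $G$ be a compact Hausdorff topological group. Then every function $f:A\to G$ factors through a group homomorphism from the big free group $BF(A)$ to $G$; that is, there is a group homomorphism $F:BF(A)\to G$ such that $F(a)=f(a)$ for every $a\in A$, where $a\in A$ is regarded as a one-letter word in $BF(A)$.
   Context: Transfinite words. Let $A=\{a_1,a_2,\dots\}$ be a countable set and $A^{-1}$ the set of formal inverses of its elements (with $(a^{-1})^{-1}=a$). A transfinite word over $A$ is a map $w:S\to A\cup A^{-1}$, where $S$ is a countable linearly ordered set, such that the preimage of every element of $A\cup A^{-1}$ is finite. Two words $w_1:S_1\to A\cup A^{-1}$ and $w_2:S_2\to A\cup A^{-1}$ are identified if there is an order-preserving bijection $\phi:S_1\to S_2$ with $w_1=w_2\circ \phi$. The product $w_1w_2$ is the concatenation: its domain is the disjoint union of $S_1$ and $S_2$ with every element of $S_1$ preceding every element of $S_2$. Cancellation. Write $[a,b]_S=\{s\in S: a\le s\le b\}$. A word $w:S\to A\cup A^{-1}$ admits a cancellation if there are a nonempty subset $T\subseteq S$ and a map $\ast:T\to T$ such that for all $t\in T$: $\ast$ is an involution; $[t,t^\ast]_S=[t,t^\ast]_T$; $[t,t^\ast]_T=([t,t^\ast]_T)^\ast$; and $w(t^\ast)=w(t)^{-1}$. The word $w|_{S\setminus T}$ is said to arise from $w$ by a cancellation. A word is reduced if it admits no cancellation. Words are considered equivalent under the equivalence relation generated by cancellations. It is known that each equivalence class contains a unique reduced word and that the equivalence classes form a group under concatenation; this is the big free group $BF(A)$.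 *)

(* Defs.v *)
From HB Require Import structures.
From Stdlib Require Import Relations.
From mathcomp Require Import all_boot all_order.
From mathcomp Require Import boolp classical_sets functions cardinality.
From mathcomp Require Import filter topology.

Set Implicit Arguments.
Unset Strict Implicit.
Unset Printing Implicit Defensive.

Local Open Scope classical_set_scope.
Local Open Scope quotient_scope.

(* [(a, false)] is the letter a and [(a, true)] its formal inverse. *)
Definition letter (A : countType) : Type := (A * bool)%type.
Definition linv (A : countType) (l : letter A) : letter A := (l.1, ~~ l.2).

(* The linear order is given as a relation rather than as an [orderType]: all
   structures of the hierarchy share one universe, so that a record with an
   [orderType] field could not itself be made into a [groupType].  Likewise,
   [rel wdom] would force this type into too large a universe. *)
Record word (A : countType) := Word {
  wdom :> Type;
  wle : wdom -> wdom -> bool;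
  wfun : wdom -> letter A;
  wle_anti : antisymmetric wle;
  wle_trans : transitive wle;
  wle_total : total wle;
  wcountable : countable [set: wdom];
  wfinite : forall l, finite_set (wfun @^-1` [set l]) }.

Definition wiso (A : countType) (w1 w2 : word A) : Prop :=
  exists phi : w1 -> w2,
    [/\ bijective phi, {mono phi : s t / wle s t} &
        forall s, wfun s = wfun (phi s)].

Lemma inj_countable T U (f : T -> U) :
  injective f -> countable [set: U] -> countable [set: T].
Proof.
move=> finj /countable_injP[g ginj]; apply/countable_injP; exists (g \o f).
by move=> x y _ _ gfxy; apply: finj; apply: ginj; rewrite ?inE.
Qed.

Lemma inj_finite_set T U (f : T -> U) (B : set U) :
  injective f -> finite_set B -> finite_set (f @^-1` B).
Proof. by move=> finj; apply: finite_preimage => x y _ _ /finj. Qed.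

Section Restriction.
Variables (A : countType) (w : word A) (D : set w).

Let dom : Type := {s : w | s \in D}.
Let le (s t : dom) : bool := wle (sval s) (sval t).
Let f (s : dom) : letter A := wfun (sval s).

Let sval_inj : injective (@sval w (fun s => s \in D)).
Proof. by move=> [x xD] [y yD] /= xy; apply: eq_exist. Qed.

Fact wrestr_anti : antisymmetric le.
Proof. by move=> s t st; apply/sval_inj/wle_anti. Qed.
Fact wrestr_trans : transitive le. Proof. by move=> s t u; apply: wle_trans. Qed.
Fact wrestr_total : total le. Proof. by move=> s t; apply: wle_total. Qed.
Fact wrestr_countable : countable [set: dom].
Proof. exact: inj_countable sval_inj (@wcountable _ w). Qed.
Fact wrestr_finite l : finite_set (f @^-1` [set l]).
Proof. by have := inj_finite_set sval_inj (@wfinite _ w l); exact. Qed.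

Definition wrestr : word A :=
  Word wrestr_anti wrestr_trans wrestr_total wrestr_countable wrestr_finite.

End Restriction.

Section SmallWords.
Variable A : countType.

Definition wempty : word A.
Proof.
by refine (@Word A void (fun _ _ => true) (fun s => match s with end)
  _ _ _ (countableP _) (fun=> finite_finset)); case.
Defined.

Definition wletter (a : A) : word A.
Proof.
by refine (@Word A unit (fun _ _ => true) (fun=> (a, false))
  _ _ _ (countableP _) (fun=> finite_finset)) => // -[] [].
Defined.

End SmallWords.

Section Concatenation.
Variables (A : countType) (w1 w2 : word A).

Let le (s t : w1 + w2) : bool :=
  match s, t with
  | inl s1, inl t1 => wle s1 t1
  | inl _, inr _ => true
  | inr _, inl _ => false
  | inr s2, inr t2 => wle s2 t2
  end.

Let f (s : w1 + w2) : letter A :=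
  match s with inl s1 => wfun s1 | inr s2 => wfun s2 end.

Fact wcat_anti : antisymmetric le.
Proof. by case=> s [] t //= /wle_anti ->. Qed.
Fact wcat_trans : transitive le.
Proof. by case=> s [] t [] u //=; apply: wle_trans. Qed.
Fact wcat_total : total le.
Proof. by case=> s [] t //=; apply: wle_total. Qed.

Fact wcat_countable : countable [set: w1 + w2].
Proof.
have /countable_injP[g ginj] := @wcountable _ w1.
have /countable_injP[h hinj] := @wcountable _ w2.
apply: (@inj_countable _ (nat + nat)%type
  (fun s => match s with inl x => inl (g x) | inr y => inr (h y) end)).
  by case=> x [] y // []; [move/ginj | move/hinj] => ->; rewrite ?inE.
exact: countableP.
Qed.

Fact wcat_finite l : finite_set (f @^-1` [set l]).
Proof.
have -> : f @^-1` [set l] =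
    inl @` (@wfun _ w1 @^-1` [set l]) `|` inr @` (@wfun _ w2 @^-1` [set l]).
  apply/seteqP; split=> [[] s /= sl|s [] [t tl <-]//].
  - by left; exists s.
  - by right; exists s.
by rewrite finite_setU; split; apply: finite_image; apply: wfinite.
Qed.

Definition wcat : word A :=
  Word wcat_anti wcat_trans wcat_total wcat_countable wcat_finite.

End Concatenation.

Lemma linvK (A : countType) : involutive (@linv A).
Proof. by case=> a b; rewrite /linv /= negbK. Qed.

Section FormalInverse.
Variables (A : countType) (w : word A).

Let le (s t : w) : bool := wle t s.
Let f (s : w) : letter A := linv (wfun s).

Fact winv_anti : antisymmetric le.
Proof. by move=> s t; rewrite /le andbC; apply: wle_anti. Qed.
Fact winv_trans : transitive le.
Proof. by move=> s t u st us; apply: wle_trans us st. Qed.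
Fact winv_total : total le. Proof. by move=> s t; apply: wle_total. Qed.

Fact winv_finite l : finite_set (f @^-1` [set l]).
Proof.
have -> : f @^-1` [set l] = @wfun _ w @^-1` [set linv l].
  apply/seteqP; split=> s /=; rewrite /f.
  - by move=> <-; rewrite linvK.
  - by move=> ->; rewrite linvK.
exact: wfinite.
Qed.

Definition winv : word A :=
  Word winv_anti winv_trans winv_total (@wcountable _ w) winv_finite.

End FormalInverse.

Definition seg (A : countType) (w : word A) (T : set w) (a b : w) : set w :=
  [set s | [/\ T s, wle a s & wle s b]].

(* The involution of [T] is the restriction to [T] of [star]; the values of
   [star] outside [T] play no role. *)
Definition is_cancellation (A : countType) (w : word A) (T : set w)
    (star : w -> w) : Prop :=
  [/\ T !=set0, set_fun T T star &
      forall t, T t ->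
        [/\ star (star t) = t,
            seg setT t (star t) = seg T t (star t),
            seg T t (star t) = star @` seg T t (star t) &
            wfun (star t) = linv (wfun t)]].

(* Words are considered up to isomorphism, whence [wiso] here and in
   [wequiv]. *)
Definition cancels_to (A : countType) (w1 w2 : word A) : Prop :=
  exists (T : set w1) (star : w1 -> w1),
    is_cancellation T star /\ wiso w2 (wrestr (~` T)).

Definition wequiv (A : countType) : word A -> word A -> Prop :=
  clos_refl_sym_trans (word A) (fun w1 w2 => wiso w1 w2 \/ cancels_to w1 w2).

Section Congruence.
Variable A : countType.
Implicit Types w u v : word A.

Lemma wiso_equiv w1 w2 : wiso w1 w2 -> wequiv w1 w2.
Proof. by move=> h; apply: rst_step; left. Qed.

Lemma wiso_refl w : wiso w w.
Proof. by exists id; split=> //; exists id. Qed.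

Lemma wiso_trans w1 w2 w3 : wiso w1 w2 -> wiso w2 w3 -> wiso w1 w3.
Proof.
move=> [f [fb fm ff]] [g [gb gm gf]]; exists (g \o f).
split=> [|s t|s /=]; first exact: bij_comp.
- by rewrite /= gm fm.
- by rewrite ff gf.
Qed.

Lemma mono_wiso w1 w2 (phi : w1 -> w2) : {mono phi : s t / wle s t} ->
  (forall t, exists s, phi s = t) -> (forall s, wfun s = wfun (phi s)) ->
  wiso w1 w2.
Proof.
move=> phi_mono /choice[psi psiK] phi_fun; exists phi; split=> //.
have refl w (s : w) : wle s s by have := wle_total s s; rewrite orbb.
exists psi => // s; apply: wle_anti.
by rewrite -!phi_mono psiK !refl.
Qed.

Lemma wiso_cat w1 w2 u1 u2 :
  wiso w1 w2 -> wiso u1 u2 -> wiso (wcat w1 u1) (wcat w2 u2).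
Proof.
move=> [f [[f' fK f'K] fm ff]] [g [[g' gK g'K] gm gf]].
pose phi (s : wcat w1 u1) : wcat w2 u2 :=
  match s with inl x => inl (f x) | inr y => inr (g y) end.
apply: (@mono_wiso _ _ phi) => [[] s [] t //||[]//].
- exact: fm.
- exact: gm.
- by case=> t; [exists (inl (f' t)) | exists (inr (g' t))]; rewrite /= ?f'K ?g'K.
Qed.

Lemma cancels_catl w1 w2 u : cancels_to w1 w2 -> cancels_to (wcat w1 u) (wcat w2 u).
Proof.
move=> [T [star [[[t0 Tt0] starT starP] w2E]]].
pose star' (s : wcat w1 u) : wcat w1 u :=
  match s with inl x => inl (star x) | inr y => inr y end.
pose T' : set (wcat w1 u) := inl @` T.
exists T', star'; split.
  split; first by exists (inl t0), t0.
    by move=> _ [t Tt <-]; exists (star t) => //; apply: starT.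
  move=> _ [t Tt <-]; have [stK segE segS stf] := starP t Tt.
  split; [by rewrite /= stK| | |exact: stf].
  - apply/seteqP; split=> [[] s [_ ts1 ts2] //|s [_ ts1 ts2]//].
    have [Ts _ _] : seg T t (star t) s by rewrite -segE; split.
    by split=> //; exists s.
  - apply/seteqP; split=> [_ [[s Ts <-] ts1 ts2]|_ [_ [[s Ts <-] ts1 ts2] <-]].
      have : seg T t (star t) s by split.
      rewrite segS => -[r [Tr tr1 tr2] <-]; exists (inl r) => //.
      by split=> //; exists r.
    have : seg T t (star t) (star s) by rewrite segS; exists s.
    by case=> Tss tss1 tss2; split=> //; exists (star s).
apply: wiso_trans (wiso_cat w2E (wiso_refl u)) _.
have hl (x : wrestr (~` T)) : (inl (sval x) : wcat w1 u) \in ~` T'.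
  by apply/mem_set => -[y Ty [yx]]; apply: (set_mem (svalP x)); move: Ty; rewrite yx.
have hr (y : u) : (inr y : wcat w1 u) \in ~` T'.
  by apply/mem_set => -[].
pose phi (s : wcat (wrestr (~` T)) u) : wrestr (~` T') :=
  match s with
  | inl x => exist (fun s => s \in ~` T') (inl (sval x)) (hl x)
  | inr y => exist (fun s => s \in ~` T') (inr y) (hr y)
  end.
apply: (@mono_wiso _ _ phi) => [[] s [] t //| |[]//].
case=> -[x|y] xT; last by exists (inr y); apply: eq_exist.
have xnT : x \in ~` T.
  by apply/mem_set => Tx; move/set_mem: xT; apply; exists x.
by exists (inl (exist (fun s => s \in ~` T) x xnT)); apply: eq_exist.
Qed.

Lemma cancels_catr w1 w2 u : cancels_to w1 w2 -> cancels_to (wcat u w1) (wcat u w2).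
Proof.
move=> [T [star [[[t0 Tt0] starT starP] w2E]]].
pose star' (s : wcat u w1) : wcat u w1 :=
  match s with inr x => inr (star x) | inl y => inl y end.
pose T' : set (wcat u w1) := inr @` T.
exists T', star'; split.
  split; first by exists (inr t0), t0.
    by move=> _ [t Tt <-]; exists (star t) => //; apply: starT.
  move=> _ [t Tt <-]; have [stK segE segS stf] := starP t Tt.
  split; [by rewrite /= stK| | |exact: stf].
  - apply/seteqP; split=> [[] s [_ ts1 ts2] //|s [_ ts1 ts2]//].
    have [Ts _ _] : seg T t (star t) s by rewrite -segE; split.
    by split=> //; exists s.
  - apply/seteqP; split=> [_ [[s Ts <-] ts1 ts2]|_ [_ [[s Ts <-] ts1 ts2] <-]].
      have : seg T t (star t) s by split.
      rewrite segS => -[r [Tr tr1 tr2] <-]; exists (inr r) => //.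
      by split=> //; exists r.
    have : seg T t (star t) (star s) by rewrite segS; exists s.
    by case=> Tss tss1 tss2; split=> //; exists (star s).
apply: wiso_trans (wiso_cat (wiso_refl u) w2E) _.
have hr (x : wrestr (~` T)) : (inr (sval x) : wcat u w1) \in ~` T'.
  by apply/mem_set => -[y Ty [yx]]; apply: (set_mem (svalP x)); move: Ty; rewrite yx.
have hl (y : u) : (inl y : wcat u w1) \in ~` T'.
  by apply/mem_set => -[].
pose phi (s : wcat u (wrestr (~` T))) : wrestr (~` T') :=
  match s with
  | inl y => exist (fun s => s \in ~` T') (inl y) (hl y)
  | inr x => exist (fun s => s \in ~` T') (inr (sval x)) (hr x)
  end.
apply: (@mono_wiso _ _ phi) => [[] s [] t //| |[]//].
case=> -[y|x] xT; first by exists (inl y); apply: eq_exist.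
have xnT : x \in ~` T.
  by apply/mem_set => Tx; move/set_mem: xT; apply; exists x.
by exists (inr (exist (fun s => s \in ~` T) x xnT)); apply: eq_exist.
Qed.

Lemma wequiv_cat w1 w2 u1 u2 :
  wequiv w1 w2 -> wequiv u1 u2 -> wequiv (wcat w1 u1) (wcat w2 u2).
Proof.
move=> w12 u12; apply: (@rst_trans _ _ _ (wcat w2 u1)).
- elim: w12 => {w1 w2} [w1 w2 [h|h]|w|w1 w2 _|w1 w2 w3 _ h1 _ h2].
  + by apply: wiso_equiv; apply: wiso_cat => //; apply: wiso_refl.
  + by apply: rst_step; right; apply: cancels_catl.
  + exact: rst_refl.
  + exact: rst_sym.
  + exact: rst_trans h2.
- elim: u12 => {u1 u2} [u1 u2 [h|h]|u|u1 u2 _|u1 u2 u3 _ h1 _ h2].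
  + by apply: wiso_equiv; apply: wiso_cat => //; apply: wiso_refl.
  + by apply: rst_step; right; apply: cancels_catr.
  + exact: rst_refl.
  + exact: rst_sym.
  + exact: rst_trans h2.
Qed.

Lemma wcatA w1 w2 w3 : wiso (wcat w1 (wcat w2 w3)) (wcat (wcat w1 w2) w3).
Proof.
pose phi (s : wcat w1 (wcat w2 w3)) : wcat (wcat w1 w2) w3 :=
  match s with
  | inl x => inl (inl x)
  | inr (inl x) => inl (inr x)
  | inr (inr x) => inr x
  end.
apply: (@mono_wiso _ _ phi) => [[s|[s|s]] [t|[t|t]] //||[s|[s|s]]//].
case=> [[t|t]|t]; [exists (inl t) | exists (inr (inl t)) | exists (inr (inr t))];
  by [].
Qed.

Lemma wcat1w w : wiso w (wcat (wempty A) w).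
Proof.
apply: (@mono_wiso _ _ (inr : w -> wcat (wempty A) w)) => //.
by case=> [[]//|t]; exists t.
Qed.

Lemma wcatw1 w : wiso w (wcat w (wempty A)).
Proof.
apply: (@mono_wiso _ _ (inl : w -> wcat w (wempty A))) => //.
by case=> [t|[]//]; exists t.
Qed.

Lemma total_cancel w (star : w -> w) : involutive star ->
  (forall t s, wle t s -> wle s (star t) ->
     wle t (star s) /\ wle (star s) (star t)) ->
  (forall t, wfun (star t) = linv (wfun t)) -> wequiv w (wempty A).
Proof.
move=> starK starS starf.
pose phi (i : wempty A) : w := match i with end.
have [[t0 _]|w0] := pselect ([set: w] !=set0).
  apply: rst_step; right; exists setT, star; split.
    split=> //; first by exists t0.
    move=> t _; split=> //; apply/seteqP.
    split=> [s [_ ts st]|_ [s [_ ts st] <-]].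
    - by exists (star s) => //; have [] := starS _ _ ts st; split.
    - by have [] := starS _ _ ts st; split.
  pose psi (i : wempty A) : wrestr (~` [set: w]) := match i with end.
  apply: (@mono_wiso _ _ psi); [by case | | by case].
  by case=> t tD; case: (set_mem tD).
apply: rst_sym; apply: wiso_equiv; apply: (@mono_wiso _ _ phi); [by case | | by case].
by move=> t; case: w0; exists t.
Qed.

Lemma wcatVw w : wequiv (wcat (winv w) w) (wempty A).
Proof.
pose star (s : wcat (winv w) w) : wcat (winv w) w :=
  match s with inl x => inr x | inr x => inl x end.
apply: (@total_cancel _ star); first by case.
- by case=> t [] s.
- by case=> t //=; rewrite linvK.
Qed.

Lemma wcatwV w : wequiv (wcat w (winv w)) (wempty A).
Proof.
pose star (s : wcat w (winv w)) : wcat w (winv w) :=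
  match s with inl x => inr x | inr x => inl x end.
apply: (@total_cancel _ star); first by case.
- by case=> t [] s.
- by case=> t //=; rewrite linvK.
Qed.

End Congruence.

HB.instance Definition _ (A : countType) := gen_eqMixin (word A).
HB.instance Definition _ (A : countType) := gen_choiceMixin (word A).

Section BigFreeGroup.
Variable A : countType.

Definition wequivb (w1 w2 : word A) : bool := `[< wequiv w1 w2 >].

Fact wequivb_refl : reflexive wequivb.
Proof. by move=> w; apply/asboolP; apply: rst_refl. Qed.
Fact wequivb_sym : symmetric wequivb.
Proof. by move=> w1 w2; apply/asboolP/asboolP; apply: rst_sym. Qed.
Fact wequivb_trans : transitive wequivb.
Proof.
by move=> w2 w1 w3 /asboolP h12 /asboolP h23; apply/asboolP; apply: rst_trans h23.
Qed.

Canonical wequiv_rel := EquivRel wequivb wequivb_refl wequivb_sym wequivb_trans.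

Definition BF : Type := {eq_quot wequivb}.
HB.instance Definition _ : EqQuotient _ wequivb BF := EqQuotient.on BF.
HB.instance Definition _ := Choice.on BF.

Lemma BF_eqP (w1 w2 : word A) : \pi_BF w1 = \pi_BF w2 <-> wequiv w1 w2.
Proof.
by split=> [/eqP|h]; [|apply/eqP]; rewrite eqmodE; [move/asboolP|apply/asboolP].
Qed.

Definition BFmul (x y : BF) : BF := \pi_BF (wcat (repr x) (repr y)).
Definition BFone : BF := \pi_BF (wempty A).
Definition BFinv (x : BF) : BF := \pi_BF (winv (repr x)).

Lemma BFmulE (w1 w2 : word A) :
  BFmul (\pi_BF w1) (\pi_BF w2) = \pi_BF (wcat w1 w2).
Proof. by apply/BF_eqP; apply: wequiv_cat; apply/BF_eqP; rewrite reprK. Qed.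

Fact BFmulA : associative BFmul.
Proof.
elim/quotW=> x; elim/quotW=> y; elim/quotW=> z; rewrite (BFmulE y z) (BFmulE x y) !BFmulE.
by apply/BF_eqP; apply: wiso_equiv; apply: wcatA.
Qed.

Fact BFmul1 : left_id BFone BFmul.
Proof.
elim/quotW=> x; rewrite BFmulE; apply/esym.
by apply/BF_eqP; apply: wiso_equiv; apply: wcat1w.
Qed.

Fact BFmulw1 : right_id BFone BFmul.
Proof.
elim/quotW=> x; rewrite BFmulE; apply/esym.
by apply/BF_eqP; apply: wiso_equiv; apply: wcatw1.
Qed.

Fact BFmulV : left_inverse BFone BFinv BFmul.
Proof.
move=> x; rewrite -[x in BFmul _ x]reprK BFmulE.
by apply/BF_eqP; apply: wcatVw.
Qed.

Fact BFmulwV : right_inverse BFone BFinv BFmul.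
Proof.
move=> x; rewrite -[x in BFmul x _]reprK BFmulE.
by apply/BF_eqP; apply: wcatwV.
Qed.

HB.instance Definition _ := isGroup.Build BF
  BFmulA BFmul1 BFmulw1 BFmulV BFmulwV.

Definition BFletter (a : A) : BF := \pi_BF (wletter a).

End BigFreeGroup.

HB.structure Definition PreTopologicalGroup := {G of Topological G & Group G}.

HB.mixin Record PreTopologicalGroup_isTopologicalGroup G
    of PreTopologicalGroup G := {
  mulg_continuous : continuous (fun x : G * G => (x.1 * x.2)%g);
  invg_continuous : continuous (fun x : G => (x^-1)%g)
}.

#[short(type="topologicalGroupType")]
HB.structure Definition TopologicalGroup :=
  {G of PreTopologicalGroup G & PreTopologicalGroup_isTopologicalGroup G}.

(* Main.v *)
Require Import Defs.
From HB Require Import structures.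
From mathcomp Require Import all_boot all_order.
From mathcomp Require Import boolp classical_sets functions cardinality.
From mathcomp Require Import filter topology zify.

Set Implicit Arguments.
Unset Strict Implicit.
Unset Printing Implicit Defensive.

Local Open Scope classical_set_scope.

(* For a finite set B of letters, the letters of a word that come from B form a
   finite word, whose value in G is multiplicative and invariant under
   cancellation: a cancellation restricts to a noncrossing pairing of finitely
   many letters.  This gives a homomorphism BF(A) -> G for each of the finite sets
   B_n = {a | pickle a < n}; since G is compact Hausdorff, they converge pointwise
   along a nonprincipal ultrafilter on n, and the limit is the wanted homomorphism. *)

(** Classical decidable equality on positions, so that finite sequences of positions can be tested
    for membership and filtered. *)
HB.instance Definition _ (A : countType) (w : word A) := gen_eqMixin (wdom w).

(** * Strict order on the positions of a word *)

Section StrictOrder.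
Context {A : countType} {w : word A}.
Implicit Types s t : w.

Lemma wle_refl s : wle s s.
Proof. by have := @wle_total _ w s s; rewrite orbb. Qed.

Definition wlt s t : bool := wle s t && ~~ wle t s.

Lemma wlt_irr : irreflexive wlt.
Proof. by move=> s; rewrite /wlt andbN. Qed.

Lemma wltW s t : wlt s t -> wle s t.
Proof. by case/andP. Qed.

Lemma wlt_trans : transitive wlt.
Proof.
move=> t s u /andP[st nts] /andP[tu _]; rewrite /wlt (@wle_trans _ w t s u) //=.
by apply: contra nts => us; apply: (@wle_trans _ w u).
Qed.

Lemma wltNge s t : wlt s t -> wle t s -> False.
Proof. by case/andP=> _ /negP. Qed.

Lemma wle_lt s t : wle s t -> s != t -> wlt s t.
Proof.
move=> st /eqP nst; rewrite /wlt st; apply/negP => ts.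
by apply: nst; apply: (@wle_anti _ w); rewrite st ts.
Qed.

End StrictOrder.

(** * Increasing enumerations of finite sets of positions *)

Section Enumeration.
Context {A : countType}.

(** Sorting by the strict order rules out repetitions, so [D] determines [e]. *)
Definition enumerates {w : word A} (D : set w) (e : seq w) : Prop :=
  sorted wlt e /\ forall s, D s <-> s \in e.

Lemma enumerates_unique (w : word A) (D : set w) e1 e2 :
  enumerates D e1 -> enumerates D e2 -> e1 = e2.
Proof.
move=> [s1 m1] [s2 m2]; apply: (irr_sorted_eq wlt_trans wlt_irr) => // s.
by apply/idP/idP => [/m1/m2|/m2/m1].
Qed.

Lemma enumerates_exists (w : word A) (D : set w) :
  finite_set D -> exists e, enumerates D e.
Proof.
move=> /finite_seqP[e ->]; exists (sort (@wle _ w) (undup e)); split; last first.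
  by move=> s; rewrite mem_sort mem_undup.
have := sort_sorted (@wle_total _ w) (undup e).
have : uniq (sort (@wle _ w) (undup e)) by rewrite sort_uniq undup_uniq.
(* Without repetitions, sortedness for [wle] improves to sortedness for [wlt]. *)
case: (sort _ _) => //= x r; elim: r x => //= y r IH x.
rewrite inE negb_or => /andP[/andP[xy xr] /andP[yr ur]] /andP[xley yr'].
by rewrite wle_lt //= IH //= yr.
Qed.

Lemma enumerates_iso (w1 w2 : word A) (D : set w2) (phi : w1 -> w2) e :
  {mono phi : s t / wle s t} -> (forall t, exists s, phi s = t) ->
  enumerates (phi @^-1` D) e -> enumerates D (map phi e).
Proof.
move=> phim phis [se me]; split.
  by rewrite sorted_map; apply: sub_sorted se => s t; rewrite /= /wlt !phim.
have phii : injective phi.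
  by move=> s t st; apply: (@wle_anti _ w1); rewrite -!phim st wle_refl.
by move=> t; have [s <-] := phis t; rewrite mem_map //; exact: me.
Qed.

Lemma enumerates_cat (w1 w2 : word A) (D : set (wcat w1 w2)) e1 e2 :
  enumerates (inl @^-1` D) e1 -> enumerates (inr @^-1` D) e2 ->
  enumerates D ([seq (inl s : wcat w1 w2) | s <- e1] ++
                [seq (inr s : wcat w1 w2) | s <- e2]).
Proof.
move=> [s1 m1] [s2 m2]; split.
  rewrite (sorted_pairwise wlt_trans) pairwise_cat !pairwise_map.
  rewrite -!(sorted_pairwise wlt_trans) s1 s2 !andbT.
  by apply/allrelP => _ _ /mapP[s _ ->] /mapP[t _ ->].
case=> s; rewrite mem_cat.
- split=> [/m1 se|/orP[/mapP[t te [->]]|/mapP[t te //]]]; last exact/m1.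
  by rewrite map_f.
- split=> [/m2 se|/orP[/mapP[t te //]|/mapP[t te [->]]]]; last exact/m2.
  by rewrite orbC map_f.
Qed.

(** Deleting positions from a word thus becomes filtering its enumeration: both sides are strictly
    sorted with the same members. *)
Lemma enumerates_restr (w : word A) (D E : set w) e (e' : seq (wrestr E)) :
  enumerates D e -> enumerates [set s : wrestr E | D (sval s)] e' ->
  [seq sval s | s : wrestr E <- e'] = [seq s <- e | s \in E].
Proof.
move=> [se me] [se' me']; apply: (irr_sorted_eq wlt_trans wlt_irr).
- by rewrite sorted_map.
- exact: (sorted_filter wlt_trans).
move=> s; rewrite mem_filter; apply/idP/idP.
  by move=> /mapP[t te ->]; rewrite (svalP t) /=; apply/me/(me' t).2.
move=> /andP[sE /me Ds]; apply/mapP.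
by exists (exist _ s sE : wrestr E) => //; apply/me'.
Qed.

End Enumeration.

(** * Values in [G] of finite sequences of positions *)

Section Evaluation.
Context {A : countType} {G : groupType} (f : A -> G).

Definition letter_val (l : letter A) : G :=
  if l.2 then ((f l.1)^-1)%g else f l.1.

Lemma letter_val_linv l : letter_val (linv l) = ((letter_val l)^-1)%g.
Proof. by case: l => a []; rewrite /letter_val /= ?invgK. Qed.

Definition letters_in (w : word A) (B : set A) : set w :=
  [set s | B (wfun s).1].
Arguments letters_in w B _ : clear implicits.

(** Each element of [B] contributes two signed letters, and each of these occurs finitely often in a
    word. *)
Lemma letters_in_finite w B : finite_set B -> finite_set (letters_in w B).
Proof.
move=> Bfin.
have -> : letters_in w B =
    \bigcup_(a in B) \bigcup_(b in [set: bool]) (@wfun _ w @^-1` [set (a, b)]).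
  apply/seteqP; split=> [s Bs|s [a Ba [b _ /= sab]]].
    by exists (wfun s).1 => //; exists (wfun s).2 => //=; case: wfun.
  by rewrite /letters_in /= sab.
apply: bigcup_finite => // a _; apply: bigcup_finite => // b _.
exact: wfinite.
Qed.

Definition seq_val {w : word A} (e : seq w) : G :=
  (\prod_(s <- e) letter_val (wfun s))%g.

(* The pairing [star] is noncrossing, so the partner of the first letter [x] of
   a finite trace cuts the trace into two blocks, each closed under [star],
   and the first block is cancelled entirely. *)
Lemma seq_val_cancellation (w : word A) (T : set w) (star : w -> w) e :
  is_cancellation T star -> sorted wlt e ->
  (forall s, T s -> s \in e -> star s \in e) ->
  seq_val e = seq_val [seq s <- e | s \in ~` T].
Proof.
move=> [_ starT starP].
(* A fixed point would carry a letter equal to its own formal inverse, but the signs differ. *)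
have star_neq s : T s -> star s <> s.
  move=> /starP[_ _ _ + sE]; rewrite sE; case: wfun => a b.
  by move=> /(congr1 snd) /=; case: b.
have [n] := ubnP (size e); elim: n e => // n IH [|x e] //= size_e sorted_e clos.
have sub_e : sorted wlt e by apply: path_sorted sorted_e.
have xlt s : s \in e -> wlt x s.
  by move: s; apply/allP; apply: order_path_min sorted_e; exact: wlt_trans.
have xNe : x \notin e by apply/negP => /xlt; rewrite wlt_irr.
have [xT|xNT] := boolP (x \in ~` T).
  rewrite /seq_val !big_cons -!/(seq_val _); congr (_ * _)%g.
  apply: IH => // s Ts se; have := clos s Ts; rewrite !inE se orbT => /(_ isT).
  case/orP=> // /eqP sx; case: (set_mem xT).
  by rewrite -sx; apply: starT.
have Tx : T x by apply: contrapT => nTx; move/negP: xNT; apply; apply/mem_set.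
have [xK segE segS xf] := starP x Tx.
have [y yE] : exists y, star x = y by exists (star x).
have ye : y \in e.
  have := clos x Tx; rewrite !inE eqxx yE => /(_ isT)/orP[/eqP yx|//].
  by case: (star_neq x Tx); rewrite yE.
have Ty : T y by rewrite -yE; apply: starT.
rewrite yE in xK segE segS xf.
case/splitPr: e / ye => e1 e2 in IH size_e sorted_e clos sub_e xlt xNe *.
rewrite size_cat /= in size_e.
have := sub_e; rewrite (sorted_pairwise wlt_trans) pairwise_cat /=.
rewrite -!(sorted_pairwise wlt_trans) => /and3P[/allrelP e1e2 se1 /andP[/allP ye2 se2]].
have e1y s : s \in e1 -> wlt s y by move=> si; apply: e1e2; rewrite ?mem_head.
(* Whatever lies between [x] and its partner [y] belongs to [T]. *)
have seg1 s : s \in e1 -> seg T x y s.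
  move=> si; rewrite -segE; split=> //; first by apply/wltW/xlt; rewrite mem_cat si.
  exact/wltW/e1y.
have e1x : x \notin e1 by apply: contra xNe; rewrite mem_cat => ->.
have e2x : x \notin e2.
  by apply: contra xNe; rewrite mem_cat inE => ->; rewrite !orbT.
have e1Ny : y \notin e1 by apply/negP => /e1y; rewrite wlt_irr.
have e2Ny : y \notin e2 by apply/negP => /ye2; rewrite wlt_irr.
(* The pairing preserves the segment from [x] to [y], and its endpoints are already paired with each
   other. *)
have clos1 s : s \in e1 -> star s \in e1.
  move=> si; have [Ts _ _] := seg1 s si.
  have [_ xs sy] : seg T x y (star s) by rewrite segS; exists s => //; exact: seg1.
  have [sK _ _ _] := starP s Ts.
  have := clos s Ts; rewrite !(inE, mem_cat) si orbT => /(_ isT).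
  case/or4P => [/eqP sx|//|/eqP sy'|/ye2/wltNge/(_ sy)//].
  - by move: e1Ny; rewrite -yE -sx sK si.
  - by move: e1x; rewrite -xK -sy' sK si.
(* A partner in [e1] would force [s] itself into [e1] by [clos1]. *)
have clos2 s : T s -> s \in e2 -> star s \in e2.
  move=> Ts si; have [sK _ _ _] := starP s Ts.
  have := clos s Ts; rewrite !(inE, mem_cat) si !orbT => /(_ isT).
  case/or4P => [/eqP sx|/clos1|/eqP sy'|//].
  - by move: e2Ny; rewrite -yE -sx sK si.
  - by rewrite sK => /e1y/wltW/wltNge; case; exact: ye2.
  - by move: e2x; rewrite -xK -sy' sK si.
have e1T : [seq s <- e1 | s \in ~` T] = [::].
  apply/eqP; rewrite -(negbK (_ == _)) -has_filter; apply/hasPn => s /seg1[Ts _ _].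
  by apply/negP => /set_mem.
have yNT : (y \in ~` T) = false by apply/negP => /set_mem.
rewrite filter_cat /= yNT e1T /= -(IH e2) //; last by lia.
(* By induction [e1] has value 1, which makes the values at [x] and [y] adjacent and mutually
   inverse. *)
have := IH e1 _ se1 (fun s _ => clos1 s); rewrite e1T /seq_val big_nil => E1.
rewrite big_cons big_cat big_cons /= E1; last by lia.
by rewrite mul1g xf letter_val_linv mulgA mulgV mul1g.
Qed.

(** * Evaluation over a finite alphabet *)

Section FiniteAlphabet.
Context {B : set A} (Bfin : finite_set B).

(** This is the projection to the free group on [B] followed by the homomorphism extending [f].
    Uniqueness of enumerations makes the chosen one immaterial. *)
Definition weval (w : word A) : G :=
  seq_val (projT1 (cid (enumerates_exists (letters_in_finite w Bfin)))).

Lemma wevalE (w : word A) e : enumerates (letters_in w B) e -> weval w = seq_val e.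
Proof. by rewrite /weval; case: cid => e' /= ee' /(enumerates_unique ee') ->. Qed.

Lemma weval_enum (w : word A) :
  exists2 e, enumerates (letters_in w B) e & weval w = seq_val e.
Proof.
have [e ee] := enumerates_exists (letters_in_finite w Bfin).
by exists e; last exact: wevalE.
Qed.

Lemma weval_iso (w1 w2 : word A) : wiso w1 w2 -> weval w1 = weval w2.
Proof.
move=> [phi [[psi phiK psiK] phim phif]].
have [e ee ->] := weval_enum w1.
have lettersE : letters_in w1 B = phi @^-1` letters_in w2 B.
  by apply/seteqP; split=> s; rewrite /letters_in /= phif.
rewrite lettersE in ee.
rewrite (wevalE (enumerates_iso phim _ ee)) => [|t]; last by exists (psi t).
by rewrite /seq_val big_map; apply: eq_bigr => s _; rewrite phif.
Qed.

Lemma weval_cancels (w1 w2 : word A) : cancels_to w1 w2 -> weval w1 = weval w2.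
Proof.
move=> [T [star [cT /weval_iso ->]]].
have [e ee ->] := weval_enum w1.
have [e' ee' ->] := weval_enum (wrestr (~` T)).
(* Partners carry the same element of [A] up to sign, so the positions with letters from [B] are
   closed under [star] within [T]. *)
rewrite (seq_val_cancellation cT ee.1) => [|s Ts /ee.2 se]; last first.
  apply/ee.2; have [_ _ /(_ s Ts)[_ _ _ sf]] := cT.
  by rewrite /letters_in /= sf.
by rewrite -(enumerates_restr ee ee') /seq_val big_map.
Qed.

Lemma weval_wequiv (w1 w2 : word A) : wequiv w1 w2 -> weval w1 = weval w2.
Proof.
elim=> {w1 w2} [w1 w2 []|w|w1 w2 _|w1 w2 w3 _ -> _] //.
- exact: weval_iso.
- exact: weval_cancels.
Qed.

Lemma weval_cat (w1 w2 : word A) :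
  weval (wcat w1 w2) = (weval w1 * weval w2)%g.
Proof.
have [e1 ee1 ->] := weval_enum w1; have [e2 ee2 ->] := weval_enum w2.
rewrite (wevalE (@enumerates_cat _ w1 w2 (letters_in (wcat w1 w2) B) e1 e2 ee1 ee2)).
by rewrite /seq_val big_cat !big_map.
Qed.

Lemma weval_letter a : B a -> weval (wletter a) = f a.
Proof.
move=> Ba; have : enumerates (letters_in (wletter a) B) [:: tt : wletter a].
  by split=> // -[]; rewrite inE eqxx.
by move=> /wevalE ->; rewrite /seq_val big_seq1.
Qed.

Lemma weval_pi (w : word A) : weval (repr (\pi_(BF A) w)%qT) = weval w.
Proof. by apply: weval_wequiv; apply/BF_eqP; rewrite reprK. Qed.

End FiniteAlphabet.

End Evaluation.

(** * Passage to the limit along an ultrafilter *)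

(** Compactness gives a cluster point of the image filter. It is a limit: if the preimage of a
    neighbourhood were not in [U], its complement would be, against clustering. *)
Lemma compact_ultra_cvg {I : Type} {T : topologicalType} (U : set_system I)
    (u : I -> T) :
  UltraFilter U -> compact [set: T] -> exists l : T, u i @[i --> U] --> l.
Proof.
move=> UU Tcompact.
have [l [_ clustl]] := Tcompact (fmap u U) _ filterT.
exists l => V Vl; have [//|UnV] := in_ultra_setVsetC (u @^-1` V) UU.
by have [x []] := clustl (~` V) V UnV Vl.
Qed.

Lemma finite_pickle_lt (A : countType) n : finite_set [set a : A | (pickle a < n)%N].
Proof.
apply: (@inj_finite_set A nat pickle `I_n); last exact: finite_II.
exact: (pcan_inj pickleK).
Qed.

Theorem mainTheorem2 (A : countType) (G : topologicalGroupType)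
    (G_compact : compact [set: G]) (G_hausdorff : hausdorff_space G)
    (f : A -> G) :
  exists F : {multiplicative BF A -> G}, forall a : A, F (BFletter a) = f a.
Proof.
(* An ultrafilter containing every cofinite set of naturals. *)
have [U [UU cofU]] := ultraFilterLemma (eventually_filter : ProperFilter \oo).
have UP : ProperFilter U by exact: ultra_proper.
pose ev n (w : word A) : G := weval f (finite_pickle_lt A n) w.
have /choice[F Fcvg] (x : BF A) : exists l : G, ev n (repr x) @[n --> U] --> l.
  exact: compact_ultra_cvg.
(* Limits in the Hausdorff space [G] are unique. *)
have FE (x : BF A) (l : G) : ev n (repr x) @[n --> U] --> l -> F x = l.
  exact: cvg_unique (Fcvg x).
have FM : {morph F : x y / (x * y)%g >-> (x * y)%g}.
  move=> x y; apply: FE.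
  (* Each [ev n] is multiplicative, and joint continuity of the product carries this to the
     limit. *)
  under eq_fun do rewrite /ev weval_pi weval_cat.
  apply: continuous2_cvg (Fcvg x) (Fcvg y).
  exact: (mulg_continuous (F x, F y)).
pose FmM := isMultiplicative.Build _ _ F FM.
pose Fm : {multiplicative BF A -> G} := HB.pack F FmM.
exists Fm => a; apply: FE; apply: cvg_near_cst; apply: cofU.
(* The alphabet at stage [n] requires [pickle a < n], so the value is constantly [f a] from this
   index on. *)
exists (pickle a).+1 => // n /= an.
by rewrite /ev weval_pi weval_letter.
Qed.
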